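(* There is an absolute constant $C>0$ such that the following holds. Let $G$ be a finite simple graph on vertex set $V$ with edge set $E$, let $p\in[0,1]$, let $\lambda:E\to[0,\infty)$, and let $R\geq 4096\sqrt{2}\,e$. Then the family \[ \mathcal{U}_0=\{U\subseteq V:\ \lambda(G[U])\geq R^2\lambda(E)p^2\} \] satisfies $\mathrm{C}^*(\mathcal{U}_0)\leq C/R$.
   Context: For a set of edges $H$, $\lambda(H)=\sum_{e\in H}\lambda(e)$; $G[U]$ is the set of edges with both endpoints in $U$. For $\mathcal{A}\subseteq 2^V$, its cost is $\mathrm{C}(\mathcal{A})=\sum_{S\in\mathcal{A}}p^{|S|}$ (with $p^0=1$); $\mathcal{A}$ covers $\mathcal{B}\subseteq 2^V$ if every member of $\mathcal{B}$ contains some member of $\mathcal{A}$; and $\mathrm{C}^*(\mathcal{B})=\min\{\mathrm{C}(\mathcal{A}):\mathcal{A}\text{ covers }\mathcal{B}\}$.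
   Formalization: The formal theorem additionally assumes p ≠ 0 and λ(E) ≠ 0; otherwise the threshold R²λ(E)p² is 0, the empty set lies in U_0, so C*(U_0) = 1 and the bound C/R fails for R > C. *)

(* Defs.v *)
From HB Require Import structures.
From mathcomp Require Import all_boot all_order all_algebra.
From mathcomp Require Import reals.

Set Implicit Arguments.
Unset Strict Implicit.
Unset Printing Implicit Defensive.

Import Order.TTheory GRing.Theory Num.Theory.
Local Open Scope ring_scope.

Record sgraph (V : finType) := SGraph {
  adj : rel V;
  adj_sym : symmetric adj;
  adj_irr : irreflexive adj }.

Definition edges (V : finType) (G : sgraph V) : {set {set V}} :=
  [set [set x; y] | x in V, y in V & adj G x y].

Definition induced_edges (V : finType) (G : sgraph V) (U : {set V}) :
    {set {set V}} :=
  [set e in edges G | e \subset U].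

(* The weight function is total on {set V}, but only its values on the edges
   of the graph are ever summed or constrained. *)
Definition weight (K : realType) (V : finType) (lam : {set V} -> K)
    (H : {set {set V}}) : K :=
  \sum_(e in H) lam e.

Definition cost (K : realType) (V : finType) (p : K) (A : {set {set V}}) : K :=
  \sum_(S in A) p ^+ #|S|.

Definition covers (V : finType) (A B : {set {set V}}) : bool :=
  [forall U in B, [exists S in A, S \subset U]].

Lemma covers_set0 (V : finType) (B : {set {set V}}) : covers [set set0] B.
Proof.
apply/forall_inP => U _; apply/exists_inP.
by exists set0; rewrite ?inE ?sub0set.
Qed.

(* [set set0] covers every family, so the arg min below ranges over a nonempty
   set of covers; min_cost_eq and min_cost_le say that it is a minimum. *)
Definition min_cost (K : realType) (V : finType) (p : K) (B : {set {set V}}) :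
    K :=
  cost p [arg min_(A < [set set0] | covers A B) cost p A]%O.

Lemma min_cost_eq (K : realType) (V : finType) (p : K) (B : {set {set V}}) :
  exists2 A, covers A B & min_cost p B = cost p A.
Proof.
rewrite /min_cost; case: arg_minP => [|A cAB _]; first exact: covers_set0.
by exists A.
Qed.

Lemma min_cost_le (K : realType) (V : finType) (p : K) (A B : {set {set V}}) :
  covers A B -> min_cost p B <= cost p A.
Proof.
rewrite /min_cost; case: arg_minP => [|A0 _ minA0]; first exact: covers_set0.
exact: minA0.
Qed.

(* If p = 0 or the total weight is 0, the threshold vanishes, set0 belongs to
   this family, and every cover of it contains set0, hence costs at least 1: no
   bound C / r with C independent of r can hold in that case. *)
Definition heavy_sets (K : realType) (V : finType) (G : sgraph V) (p : K)
    (lam : {set V} -> K) (r : K) : {set {set V}} :=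
  [set U | weight lam (induced_edges G U)
             >= r ^+ 2 * weight lam (edges G) * p ^+ 2].

(* Main.v *)
Require Import Defs.
From HB Require Import structures.
From mathcomp Require Import all_boot all_order all_algebra.
From mathcomp Require Import ring lra zify.
From mathcomp Require Import reals sequences exp.

Set Implicit Arguments.
Unset Strict Implicit.
Unset Printing Implicit Defensive.

Import Order.TTheory GRing.Theory Num.Theory.
Local Open Scope ring_scope.

(* Attach to each of finitely many "gadgets" [g] a vertex set [supp g] and a
   value [val g >= 0], and let [X] be the sum of [p ^+ #|supp g| * val g].  The
   sets that contain pairwise disjoint gadgets of total value at least [Q * X]
   can be covered at cost [8 / Q]: compare superlevel sets of [val], then cover
   by unions of disjoint gadgets.
   Three kinds of gadgets suffice: single vertices, edges, and stars with at
   least two leaves, dense in an initial segment of the neighbours of their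
   centre ordered by decreasing weight.  Removing a gadget at a vertex of maximal
   degree of the graph induced on [U] destroys an edge weight bounded by its
   value, so disjoint gadgets exhaust the weight of [U].  Since [X] is of order
   [p ^+ 2 * lambda(E)], [Q] is of order [r ^+ 2], and the cover costs only
   [O(1 / r ^+ 2)]. *)

(** * Factorials, geometric sums and elementary symmetric sums *)

(** The falling factorial of [2j] of length [j] dominates [j ^ j]; it equals ['C(2j, j) * j!], and
    the binomial is at most [2 ^ (2j)]. *)
Lemma expn_self_le (j : nat) : (j ^ j <= 4 ^ j * j`!)%N.
Proof.
have le_ffact : forall m n, (n ^ m <= (n + m) ^_ m)%N.
  elim=> [|m IH] n; first by rewrite expn0 ffactn0.
  rewrite addnS ffactSS expnS leq_mul ?IH //.
  by rewrite (leq_trans _ (leqnSn _)) ?leq_addr.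
have bin_le : forall n m, ('C(n, m) <= 2 ^ n)%N.
  elim=> [|n IH] [|m] //; first by rewrite bin0 expn_gt0.
  by rewrite binS expnS mul2n -addnn leq_add.
apply: leq_trans (le_ffact j j) _.
by rewrite -bin_ffact leq_mul2r -[4%N]/(2 ^ 2)%N -expnM mul2n -addnn bin_le orbT.
Qed.

Section Sums.

Variable K : realFieldType.

Lemma sum_geometric_half (n : nat) : \sum_(i < n) (2^-1 : K) ^+ i.+1 <= 1.
Proof.
suff -> : \sum_(i < n) (2^-1 : K) ^+ i.+1 = 1 - 2^-1 ^+ n.
  by rewrite gerBl exprn_ge0 // invr_ge0.
elim: n => [|n IH]; first by rewrite big_ord0 expr0 subrr.
by rewrite big_ord_recr /= IH exprS; field.
Qed.

Lemma exp_self_fact_le (j : nat) (Q : K) :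
  0 < Q -> (j%:R / Q) ^+ j / j`!%:R <= (4 / Q) ^+ j.
Proof.
move=> Q0; rewrite ler_pdivrMr ?ltr0n ?fact_gt0 // !expr_div_n mulrAC.
rewrite ler_wpM2r ?invr_ge0 ?exprn_ge0 ?(ltW Q0) //.
by rewrite -!natrX -natrM ler_nat expn_self_le.
Qed.

(** Marking one element in each set of size [j + 1] gives [(j + 1) e_(j+1) <= e_1 e_j] for the
    elementary symmetric sums; induct on [j]. *)
Lemma elementary_sum_le (T : finType) (mu : T -> K) (A : {set T}) (j : nat) :
  (forall t, 0 <= mu t) ->
  \sum_(H : {set T} | (H \subset A) && (#|H| == j)) \prod_(t in H) mu t
    <= (\sum_(t in A) mu t) ^+ j / j`!%:R.
Proof.
move=> mu0; elim: j => [|j IH].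
  rewrite expr0 fact0 divr1 (bigD1 set0) ?sub0set ?cards0 //= big_set0.
  by rewrite big1 ?addr0 // => H /andP[/andP[_ /eqP/cards0_eq ->]]; rewrite eqxx.
set F := fun H : {set T} => \prod_(t in H) mu t.
have F0 H : 0 <= F H by apply: prodr_ge0.
suff : j.+1%:R * \sum_(H : {set T} | (H \subset A) && (#|H| == j.+1)) F H
       <= (\sum_(t in A) mu t) *
          \sum_(H : {set T} | (H \subset A) && (#|H| == j)) F H.
  move=> le1; have j0 : 0 < j.+1%:R :> K by rewrite ltr0n.
  rewrite -(ler_pM2l j0); apply: le_trans le1 _.
  have s0 : 0 <= \sum_(t in A) mu t by apply: sumr_ge0.
  apply: le_trans (ler_wpM2l s0 IH) _.
  have jf : j`!%:R != 0 :> K by rewrite pnatr_eq0 -lt0n fact_gt0.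
  rewrite factS natrM exprS le_eqVlt; apply/orP; left; apply/eqP.
  by field; rewrite jf /= addrC -natr1 in j0 *; rewrite gt_eqF.
rewrite mulr_sumr.
have -> : \sum_(H : {set T} | (H \subset A) && (#|H| == j.+1)) j.+1%:R * F H =
  \sum_(H : {set T} | (H \subset A) && (#|H| == j.+1))
    \sum_(t in A | t \in H) F H.
  apply: eq_bigr => H /andP[/subsetP HA /eqP cH].
  rewrite (eq_bigl (mem H)); first by rewrite sumr_const cH mulr_natl.
  by move=> t; case tH: (t \in H); rewrite /= ?tH ?andbF // HA.
rewrite (exchange_big_dep (mem A)) /=; last by move=> H t _ /andP[].
rewrite mulr_suml.
apply: ler_sum => t tA.
rewrite (reindex_onto (fun H => t |: H) (fun H => H :\ t)) /=; last first.
  by move=> H /andP[_ /andP[_ tH]]; rewrite setD1K.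
rewrite mulr_sumr big_mkcond [leRHS]big_mkcond /=.
apply: ler_sum => H _; case: ifP => [/andP[/andP[/andP[sA c1] _] eqH]|_].
  have tH : t \notin H by rewrite -(eqP eqH) !inE eqxx.
  have -> : H \subset A by apply: subset_trans sA; apply: subsetUr.
  move: c1; rewrite cardsU1 tH add1n eqSS => -> /=.
  by rewrite /F big_setU1.
by case: ifP => // _; apply: mulr_ge0.
Qed.

(** * Superlevel sets *)

Definition upset (T : finType) (f : T -> K) (t : T) : {set T} :=
  [set s | f t <= f s].

(** Superlevel sets are nested, so every [t] in the sum lies in the largest of those concerned, the
    one at the least value of [f]. *)
Lemma sum_small_upsets (T : finType) (f mu : T -> K) (x : K) :
  (forall t, 0 <= mu t) -> 0 <= x ->
  \sum_(t | \sum_(s in upset f t) mu s <= x) mu t <= x.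
Proof.
move=> mu0 x0; set P := fun t => \sum_(s in upset f t) mu s <= x.
case: (pickP P) => [t0 Pt0|P0]; last by rewrite big_pred0.
case: (arg_minP f Pt0) => t Pt tmin; apply: le_trans Pt.
rewrite [leRHS](bigID P) /= -[leLHS]addr0 lerD ?sumr_ge0 //.
rewrite le_eqVlt; apply/orP; left; apply/eqP; apply: eq_bigl => s.
by rewrite inE; case Ps: (P s); rewrite ?andbF // tmin.
Qed.

(* A layer-cake comparison: if [Q * mu] dominated the counting measure of [J] on
   every superlevel set of [f], integrating over the levels would contradict
   the hypothesis. *)
Lemma dense_upset (T : finType) (f mu : T -> K) (J : {set T}) (Q : K) :
  (forall t, 0 <= f t) -> (forall t, 0 <= mu t) -> 0 <= Q ->
  Q * \sum_t mu t * f t <= \sum_(t in J) f t -> 0 < \sum_(t in J) f t ->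
  exists2 t, (t \in J) && (0 < f t) &
    Q * \sum_(s in upset f t) mu s <= #|J :&: upset f t|%:R.
Proof.
move=> f0 mu0 Q0 le1 pos1; apply/exists_inP; apply: contraLR le1.
rewrite negb_exists_in => /forall_inP sparse; rewrite -ltNge.
have [n cJ] := ubnP #|J|.
elim: n J f f0 pos1 sparse cJ => // n IH J f f0 pos1 sparse cJ.
set J1 := [set t in J | 0 < f t].
have sumJ1 : \sum_(t in J) f t = \sum_(t in J1) f t.
  rewrite [LHS](bigID (fun t => 0 < f t)) /= [X in _ + X]big1 ?addr0.
    by apply: eq_bigl => t; rewrite !inE.
  by move=> t /andP[_]; rewrite lt_neqAle f0 andbT negbK => /eqP.
have [t0 t0J1] : exists t0, t0 \in J1.
  apply/set0Pn; apply: contraTneq pos1 => J10.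
  by rewrite sumJ1 J10 big_set0 ltxx.
have [t tJ1 tmin] : exists2 t, t \in J1 & forall s, s \in J1 -> f t <= f s.
  by case: (arg_minP f t0J1) => t tJ1 tmin; exists t.
have [tJ ft0] : t \in J /\ 0 < f t by move: tJ1; rewrite inE => /andP.
(* Peel off the lowest positive level on [J]: truncation keeps the superlevel sets at points where
   [g] is positive, and [t] drops out of [J], so the induction applies. *)
pose g s := Num.max (f s - f t) 0.
have g0 s : 0 <= g s by rewrite le_max lexx orbT.
have upg s : 0 < g s -> upset g s = upset f s.
  rewrite lt_max ltxx orbF subr_gt0 => ts; apply/setP => r; rewrite !inE /g.
  rewrite [Num.max (f s - _) _]max_l ?subr_ge0 ?(ltW ts) // le_max lerD2r.
  by rewrite subr_le0 [f s <= f t]leNgt ts orbF.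
have fle : f t * \sum_(s in upset f t) mu s + \sum_s mu s * g s <= \sum_s mu s * f s.
  rewrite mulr_sumr big_mkcond -big_split /=; apply: ler_sum => s _.
  rewrite inE /g; case: (leP (f t) (f s)) => ts.
    by rewrite max_l ?subr_ge0 // mulrC -mulrDr addrC subrK.
  by rewrite max_r ?subr_le0 ?(ltW ts) // mulr0 add0r mulr_ge0.
have JE : J :&: upset f t = J1.
  apply/setP => s; rewrite !inE; case sJ: (s \in J) => //=; apply/idP/idP => h.
    exact: lt_le_trans h.
  by apply: tmin; rewrite inE sJ.
have := sparse t; rewrite tJ ft0 => /(_ isT); rewrite -ltNge JE => sp.
have sumE : \sum_(s in J) f s = f t * #|J1|%:R + \sum_(s in J1) g s.
  rewrite sumJ1 mulr_natr -sumr_const -big_split /=; apply: eq_bigr => s sJ1.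
  by rewrite /g max_l ?subr_ge0 ?tmin // addrC subrK.
have lt1 : f t * #|J1|%:R < f t * (Q * \sum_(s in upset f t) mu s).
  by rewrite ltr_pM2l.
have le2 : \sum_(s in J1) g s <= Q * \sum_s mu s * g s.
  pose J2 := J1 :\ t.
  have gt : g t = 0 by rewrite /g subrr max_l.
  rewrite (big_setD1 t) //= gt add0r -/J2.
  have : 0 <= \sum_(s in J2) g s by apply: sumr_ge0.
  rewrite le_eqVlt => /orP[/eqP <-|J2pos].
    by rewrite mulr_ge0 ?sumr_ge0 // => s _; rewrite mulr_ge0.
  apply: ltW; apply: IH => // [s /andP[sJ2 gs]|]; last first.
    move: cJ; rewrite ltnS; apply: leq_trans; rewrite [in leqRHS](cardsD1 t) tJ.
    by rewrite add1n ltnS subset_leq_card // setSD //; apply/subsetP => s; rewrite inE => /andP[].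
  rewrite upg // -ltNge; have [sJ fs] : s \in J /\ 0 < f s.
    by move: sJ2; rewrite !inE => /and3P[].
  apply: le_lt_trans (_ : #|J :&: upset f s|%:R < _); last first.
    by rewrite ltNge; apply: sparse; rewrite sJ.
  rewrite ler_nat subset_leq_card // setSI //.
  by apply/subsetP => r; rewrite !inE => /and3P[].
have le3 := ler_wpM2l Q0 fle.
by rewrite sumE; apply: lt_le_trans le3; rewrite mulrDr mulrCA ltr_leD.
Qed.

Lemma sum_imset_le (I T : finType) (h : I -> T) (A : {set I}) (F : T -> K) :
  (forall t, 0 <= F t) ->
  \sum_(t in h @: A) F t <= \sum_(i in A) F (h i).
Proof.
move=> F0; rewrite [leRHS](partition_big_imset h) /=; apply: ler_sum => t.
case/imsetP => i iA ->; rewrite (bigD1 i) ?iA ?eqxx //= -[leLHS]addr0.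
by rewrite lerD // sumr_ge0.
Qed.

End Sums.

(** * Unions of disjoint supports *)

Definition disjoint_supports (I V : finType) (supp : I -> {set V})
    (H : {set I}) : bool :=
  [forall g in H, forall h in H, (g != h) ==> [disjoint supp g & supp h]].

Lemma disjoint_supportsP (I V : finType) (supp : I -> {set V}) (H : {set I}) :
  reflect {in H &, forall g h, g != h -> [disjoint supp g & supp h]}
          (disjoint_supports supp H).
Proof.
apply: (iffP forall_inP) => [dH g h gH hH|dH g gH].
  by apply/implyP; have /forall_inP := dH g gH; apply.
by apply/forall_inP => h hH; apply/implyP; apply: dH.
Qed.

Lemma card_disjoint_supports (I V : finType) (supp : I -> {set V})
    (H : {set I}) :
  disjoint_supports supp H ->
  #|\bigcup_(g in H) supp g| = (\sum_(g in H) #|supp g|)%N.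
Proof.
move=> /disjoint_supportsP dH; pose F g := if g \in H then supp g else set0.
have -> : \bigcup_(g in H) supp g = \bigcup_g F g by rewrite big_mkcond.
rewrite -sum1_card partition_disjoint_bigcup; last first.
  move=> g h gh; rewrite /F; case: ifP => gH; last first.
    by rewrite -setI_eq0 set0I.
  by case: ifP => hH; [apply: dH | rewrite -setI_eq0 setI0].
rewrite [RHS]big_mkcond /=; apply: eq_bigr => g _.
by rewrite sum1_card /F; case: ifP => // _; rewrite cards0.
Qed.

(** * The cost of covers, and of all dense stars at a vertex *)

Section Covers.

Variable K : realType.

(* Each covered [U] contains, for some superlevel set [A] of [val], at least
   [Q * \sum_(g in A) p ^+ #|supp g|] disjoint supports taken from [A].  The
   unions of [j] disjoint supports from [A] cost at most
   [(\sum_(g in A) p ^+ #|supp g|) ^+ j / j`!], and for each [j] a single,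
   largest [A] suffices. *)
Lemma min_cost_disjoint_supports (I V : finType) (p : K)
    (supp : I -> {set V}) (val : I -> K) (Q : K) (B : {set {set V}}) :
  0 <= p -> (forall g, 0 <= val g) -> 8 <= Q ->
  (forall U, U \in B -> exists J : {set I},
     [/\ disjoint_supports supp J, forall g, g \in J -> supp g \subset U,
         0 < \sum_(g in J) val g &
         Q * \sum_g p ^+ #|supp g| * val g <= \sum_(g in J) val g]) ->
  min_cost p B <= 8 / Q.
Proof.
move=> p0 val0 Q8 heavyB; pose mu g := p ^+ #|supp g|.
have mu0 g : 0 <= mu g by apply: exprn_ge0.
have Q0 : 0 < Q by apply: lt_le_trans Q8.
pose A j := [set g | \sum_(h in upset val g) mu h <= j%:R / Q].
pose Hs := [set H : {set I} |
  [&& disjoint_supports supp H, H != set0 & H \subset A #|H|]].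
pose U_ (H : {set I}) := \bigcup_(g in H) supp g.
have cov : covers (U_ @: Hs) B.
  apply/forall_inP => U /heavyB[J [dJ sJ pos le]].
  have [t /andP[tJ _] dense] := dense_upset val0 mu0 (ltW Q0) le pos.
  apply/exists_inP; exists (U_ (J :&: upset val t)).
    apply: imset_f; rewrite inE; apply/and3P; split.
    - apply/disjoint_supportsP => g h; rewrite !inE => /andP[gJ _] /andP[hJ _].
      by have /disjoint_supportsP := dJ; apply.
    - by apply/set0Pn; exists t; rewrite !inE tJ lexx.
    - apply/subsetP => g; rewrite !inE => /andP[_ tg].
      rewrite ler_pdivlMr // mulrC; apply: le_trans dense.
      rewrite ler_pM2l // big_mkcond [leRHS]big_mkcond /=.
      apply: ler_sum => h _; rewrite !inE.
      case: (leP (val g) (val h)) => [/(le_trans tg) ->//|_].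
      by case: ifP.
  apply/bigcupsP => g; rewrite inE => /andP[gJ _]; exact: sJ.
apply: le_trans (min_cost_le p cov) _; rewrite /cost.
apply: le_trans (sum_imset_le _ _ _) _ => [S|]; first exact: exprn_ge0.
pose F (H : {set I}) := \prod_(g in H) mu g.
have F0 H : 0 <= F H by apply: prodr_ge0.
(* Sort the nonempty [H] by size [j.+1]; disjointness turns the cost of a union into a product of
   [mu]. *)
apply: (@le_trans _ _ (\sum_(j < #|I|) \sum_(H : {set I} |
    (H \subset A j.+1) && (#|H| == j.+1)) F H)).
  rewrite (exchange_big_dep predT) //= big_mkcond; apply: ler_sum => H _.
  case: ifP => [|_]; last by apply: sumr_ge0.
  rewrite inE => /and3P[dH H0 HA].
  have cH : (#|H|.-1 < #|I|)%N.
    by rewrite prednK ?max_card // card_gt0.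
  rewrite (bigD1 (Ordinal cH)) /=; last by rewrite prednK ?card_gt0 ?HA ?eqxx.
  rewrite -[leLHS]addr0 lerD ?sumr_ge0 //.
  by rewrite card_disjoint_supports // /F /mu prodrXr.
(* Size [j.+1] costs at most [(4 / Q) ^+ j.+1], and [4 / Q <= 1 / 2] since [8 <= Q]. *)
apply: (@le_trans _ _ (\sum_(j < #|I|) 8 / Q * (2^-1) ^+ j.+1)); last first.
  rewrite -mulr_sumr -[leRHS]mulr1 ler_pM2l ?divr_gt0 //.
  exact: sum_geometric_half.
apply: ler_sum => j _.
apply: le_trans (elementary_sum_le _ _ mu0) _.
apply: (@le_trans _ _ ((j.+1%:R / Q) ^+ j.+1 / j.+1`!%:R)).
  rewrite ler_wpM2r ?invr_ge0 //; apply: lerXn2r; rewrite ?nnegrE ?sumr_ge0 //.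
    by rewrite divr_ge0 // ltW.
  have := @sum_small_upsets _ _ val mu (j.+1%:R / Q) mu0.
  rewrite (eq_bigl (fun g => g \in A j.+1)); last by move=> g; rewrite inE.
  by apply; rewrite divr_ge0 // ltW.
apply: le_trans (exp_self_fact_le _ Q0) _; rewrite !exprS.
have -> : 8 / Q * (2^-1 * 2^-1 ^+ j) = 4 / Q * 2^-1 ^+ j.
  by rewrite mulrA; congr (_ * _); field; rewrite gt_eqF.
rewrite ler_pM2l ?divr_gt0 //; apply: lerXn2r; rewrite ?nnegrE.
- by rewrite divr_ge0 // ltW.
- by rewrite invr_ge0.
- by rewrite ler_pdivrMr //; lra.
Qed.

(* For a fixed number [j.+1] of leaves, [t] is determined by the superlevel set
   [upset f t], which has at most [j / (32 p)] elements, and there are at most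
   as many choices of [t]: one factor [#|upset f t|^-1] pays for the sum over
   [t], and what is left decays geometrically in [j]. *)
Lemma sum_dense_stars (V : finType) (f : V -> K) (p : K) :
  0 < p ->
  \sum_(t : V) \sum_(S : {set V} | [&& t \in S, S \subset upset f t,
      (1 < #|S|)%N & 32 * p * #|upset f t|%:R <= #|S|.-1%:R])
    p ^+ #|S| * (#|S|%:R ^+ 2 / #|upset f t|%:R) <= p.
Proof.
move=> p0; have p0' := ltW p0.
pose m t := #|upset f t|.
have m0 t : 0 < (m t)%:R :> K.
  by rewrite ltr0n card_gt0; apply/set0Pn; exists t; rewrite inE.
have m0' t := ltW (m0 t).
pose F t (S : {set V}) := p ^+ #|S| * (#|S|%:R ^+ 2 / (m t)%:R) : K.
have F0 t S : 0 <= F t S by rewrite mulr_ge0 ?exprn_ge0 // divr_ge0 ?exprn_ge0.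
pose P t (S : {set V}) j :=
  [&& t \in S, S \subset upset f t, #|S| == j.+2 & 32 * p * (m t)%:R <= j.+1%:R].
apply: (@le_trans _ _ (\sum_(j < #|V|) \sum_t \sum_(S | P t S j) F t S)).
  rewrite exchange_big /=; apply: ler_sum => t _.
  rewrite (exchange_big_dep predT) //= big_mkcond; apply: ler_sum => S _.
  case: ifP => [/and4P[tS Sup S1 dense]|_]; last by apply: sumr_ge0.
  have cS : (#|S|.-2 < #|V|)%N.
    by move: (max_card (mem S)) S1; case: #|S| => [|[|k]] //= /ltnW.
  rewrite (bigD1 (Ordinal cS)) /=; last first.
    by apply/and4P; split; move: S1 dense => //; case: #|S| => [|[|k]] //=.
  by rewrite -[leLHS]addr0 lerD ?sumr_ge0.
apply: (@le_trans _ _ (\sum_(j < #|V|) p * (2^-1) ^+ j.+1)); last first.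
  by rewrite -mulr_sumr -[leRHS]mulr1 ler_pM2l // sum_geometric_half.
apply: ler_sum => j _.
pose x : K := j.+1%:R / (32 * p).
have px : p * x = j.+1%:R / 32 by rewrite /x; field; rewrite gt_eqF.
have x0 : 0 <= x by rewrite divr_ge0 // mulr_ge0.
(* A bound on the sum over [S] for one [t]: deleting [t] leaves a subset of size [j.+1], and after
   division by [m t] the estimate still increases with [m t <= x]. *)
pose c : K := p * (p * x) ^+ j * p * j.+2%:R ^+ 2 / j.+1`!%:R.
have c0 : 0 <= c by rewrite /c !(mulr_ge0, exprn_ge0, invr_ge0).
apply: (@le_trans _ _ (\sum_(t | (m t)%:R <= x) c)).
  rewrite [leRHS]big_mkcond; apply: ler_sum => t _; case: ifP => [mx|mx]; last first.
    rewrite big_pred0 // => S; apply/negP => /and4P[_ _ _ le].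
    by move/negP: mx; apply; rewrite /x ler_pdivlMr ?mulr_gt0 // mulrC.
  pose G (S : {set V}) := \prod_(s in S) p.
  apply: (@le_trans _ _ (\sum_(S : {set V} | (S \subset upset f t) &&
      (#|S| == j.+1)) p * (j.+2%:R ^+ 2 / (m t)%:R) * G S)).
    rewrite (reindex_onto (fun S => t |: S) (fun S => S :\ t)) /=; last first.
      by move=> S /and4P[tS _ _ _]; rewrite setD1K.
    rewrite big_mkcond [leRHS]big_mkcond /=; apply: ler_sum => S _.
    have G0 : 0 <= p * (j.+2%:R ^+ 2 / (m t)%:R) * G S.
      by rewrite !mulr_ge0 ?invr_ge0 ?exprn_ge0 // prodr_ge0.
    case: ifP => [/andP[/and4P[_ sA c1 _] eqS]|_]; last by case: ifP.
    have tS : t \notin S by rewrite -(eqP eqS) !inE eqxx.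
    rewrite (subset_trans (subsetUr _ _) sA).
    move: c1; rewrite /F /G prodr_const cardsU1 tS add1n eqSS => /eqP ->.
    by rewrite eqxx /= [p ^+ j.+2]exprS -mulrA [p ^+ j.+1 * _]mulrC mulrA.
  rewrite -mulr_sumr.
  have := @elementary_sum_le K V (fun=> p) (upset f t) j.+1 (fun=> p0').
  have -> : \sum_(s in upset f t) p = p * (m t)%:R.
    by rewrite sumr_const mulr_natr.
  move=> /(ler_wpM2l
    (_ : 0 <= p * (j.+2%:R ^+ 2 / (m t)%:R))) le1.
  apply: le_trans (le1 _) _; first by rewrite !mulr_ge0 ?invr_ge0 ?exprn_ge0.
  have -> : p * (j.+2%:R ^+ 2 / (m t)%:R) * ((p * (m t)%:R) ^+ j.+1 / j.+1`!%:R)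
      = p * (p * (m t)%:R) ^+ j * p * j.+2%:R ^+ 2 / j.+1`!%:R.
    have jf : j.+1`!%:R != 0 :> K by rewrite pnatr_eq0 -lt0n fact_gt0.
    by rewrite [_ ^+ j.+1]exprS; field; rewrite jf gt_eqF.
  rewrite /c; do 3! (apply: ler_wpM2r; rewrite ?invr_ge0 ?exprn_ge0 //).
  rewrite ler_pM2l //; apply: lerXn2r; last by rewrite ler_pM2l.
    by rewrite nnegrE mulr_ge0.
  by rewrite nnegrE mulr_ge0.
have cnt : \sum_(t | (m t)%:R <= x) (1 : K) <= x.
  have := @sum_small_upsets K V f (fun=> 1) x (fun=> ler01) x0.
  by rewrite (eq_bigl (fun t => (m t)%:R <= x)) // => t; rewrite sumr_const.
rewrite -[c]mul1r -mulr_suml; apply: le_trans (ler_wpM2r c0 cnt) _.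
have -> : x * c = p * (j.+2%:R ^+ 2 * ((p * x) ^+ j.+1 / j.+1`!%:R)).
  by rewrite /c [_ ^+ j.+1]exprS; ring.
rewrite ler_pM2l // px.
(* The constant 32 is set here: the square costs 4 per leaf, [exp_self_fact_le] costs another 4, and
   [4 * 4 / 32 = 1 / 2]. *)
have le4 : j.+2%:R ^+ 2 <= 4 ^+ j.+1 :> K.
  rewrite -!natrX ler_nat; elim: (nat_of_ord j) => // k IH.
  by rewrite [(4 ^ _)%N]expnS; apply: leq_trans (_ : 4 * k.+2 ^ 2 <= _)%N; nia.
have nn : 0 <= (j.+1%:R / 32 : K) ^+ j.+1 / j.+1`!%:R.
  by rewrite divr_ge0 // exprn_ge0 // divr_ge0.
apply: le_trans (ler_wpM2r nn le4) _.
have -> : (2^-1 : K) ^+ j.+1 = 4 ^+ j.+1 * (4 / 32) ^+ j.+1.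
  by rewrite -exprMn; congr (_ ^+ _); field.
by rewrite ler_pM2l ?exprn_gt0 //; apply: exp_self_fact_le.
Qed.

End Covers.

(** * Gadgets: their total value and their greedy extraction *)

Section Gadgets.

Variables (K : realType) (V : finType) (l : V -> V -> K) (p : K).
Hypotheses (l_ge0 : forall v u, 0 <= l v u)
           (l_sym : forall v u, l v u = l u v)
           (l_irr : forall v, l v v = 0)
           (p_gt0 : 0 < p).

(** A star records its centre, a leaf [t] fixing the weight level, and its leaves; [gval] vanishes
    on triples that are not dense stars. *)
Definition gadget : finType := (V + V * V + V * V * {set V})%type.

Definition gsupp (g : gadget) : {set V} :=
  match g with
  | inl (inl v) => [set v]
  | inl (inr (v, u)) => [set v; u]
  | inr (v, t, L) => v |: L
  end.

Definition wdeg (v : V) : K := \sum_u l v u.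

(** The predecessor omits one leaf: [t] when stars are counted, the heaviest leaf when a star is
    found. *)
Definition dense_star (v t : V) (S : {set V}) : bool :=
  [&& t \in S, S \subset upset (l v) t, (1 < #|S|)%N &
      32 * p * #|upset (l v) t|%:R <= #|S|.-1%:R].

(* The values are at least [2 * #|gsupp g| * d] when [g] is extracted at a vertex
   of degree [d], and at most what [sum_gval_le] can afford. *)
Definition gval (g : gadget) : K :=
  match g with
  | inl (inl v) => 128 * p * wdeg v
  | inl (inr (v, u)) => 8 * l v u
  | inr (v, t, L) =>
      if (0 < l v t) && dense_star v t L
      then 4 * (#|L|%:R ^+ 2 / #|upset (l v) t|%:R) * wdeg v else 0
  end.

Lemma wdeg_ge0 (v : V) : 0 <= wdeg v.
Proof. exact: sumr_ge0. Qed.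

Lemma gval_ge0 (g : gadget) : 0 <= gval g.
Proof.
have p0 := ltW p_gt0; case: g => [[v|[v u]]|[[v t] S]] /=.
- by rewrite !mulr_ge0 ?wdeg_ge0.
- by rewrite mulr_ge0.
- by case: ifP => // _; rewrite !mulr_ge0 ?wdeg_ge0 ?invr_ge0 ?exprn_ge0.
Qed.

(** Vertices, edges and stars contribute [128 + 8 + 4 = 140]; for stars, the centre supplies a
    further factor [p] to [sum_dense_stars]. *)
Lemma sum_gval_le :
  \sum_g p ^+ #|gsupp g| * gval g <= 140 * p ^+ 2 * \sum_v wdeg v.
Proof.
have p0 := ltW p_gt0; rewrite !big_sumType /=.
have -> : 140 * p ^+ 2 * \sum_v wdeg v =
    128 * p ^+ 2 * \sum_v wdeg v + 8 * p ^+ 2 * \sum_v wdeg v +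
    4 * p ^+ 2 * \sum_v wdeg v by ring.
apply: lerD; first apply: lerD.
- by rewrite mulr_sumr; apply: ler_sum => v _; rewrite cards1; lra.
- pose E v u := p ^+ #|[set v; u]| * (8 * l v u).
  rewrite (eq_bigr (fun g => E g.1 g.2)) -?(pair_bigA _ E) /E /=; last by case.
  rewrite mulr_sumr; apply: ler_sum => v _; rewrite mulr_sumr.
  apply: ler_sum => u _; rewrite cards2; have [<-|vu] := eqVneq v u.
    by rewrite l_irr !mulr0.
  by lra.
pose F v t S := p ^+ #|v |: S| * gval (inr (v, t, S)).
rewrite (eq_bigr (fun g => F g.1.1 g.1.2 g.2)); last by case=> [[]].
rewrite -(pair_bigA _ (fun vt S => F vt.1 vt.2 S)) /=.
rewrite -(pair_bigA _ (fun v t => \sum_S F v t S)) /=.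
rewrite mulr_sumr; apply: ler_sum => v _.
pose c := 4 * p * wdeg v.
have c0 : 0 <= c by rewrite !mulr_ge0 ?wdeg_ge0.
have -> : 4 * p ^+ 2 * wdeg v = c * p by rewrite /c; ring.
apply: le_trans (ler_wpM2l c0 (sum_dense_stars (l v) p_gt0)).
rewrite mulr_sumr; apply: ler_sum => t _; rewrite mulr_sumr [leRHS]big_mkcond.
apply: ler_sum => S _; rewrite /F /=.
rewrite -/(dense_star v t S); case: ifP => [/andP[lt0 dS]|_]; last first.
  rewrite mulr0; case: ifP => // _.
  by rewrite !mulr_ge0 ?wdeg_ge0 ?invr_ge0 ?exprn_ge0.
(* Leaves have weight at least [l v t > 0], whereas [l v v = 0]. *)
rewrite dS cardsU1; have -> : v \notin S.
  apply: contraTN lt0 => vS; case/and4P: dS => _ /subsetP/(_ v vS) + _ _.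
  by rewrite inE l_irr -leNgt.
by rewrite add1n exprS /c; lra.
Qed.

(** Each vertex of [Z] loses one row and, by symmetry, one column, each of sum at most [d]. *)
Lemma induced_sum_remove (U Z : {set V}) (d : K) :
  Z \subset U -> (forall v, v \in U -> \sum_(u in U) l v u <= d) ->
  \sum_(v in U) \sum_(u in U) l v u <=
  \sum_(v in U :\: Z) \sum_(u in U :\: Z) l v u + 2 * #|Z|%:R * d.
Proof.
move=> ZU deg.
have sumZ (F : V -> K) :
    \sum_(v in U) F v = \sum_(v in Z) F v + \sum_(v in U :\: Z) F v.
  by rewrite (big_setID Z) /= (setIidPr ZU).
have degZ : \sum_(v in Z) \sum_(u in U) l v u <= #|Z|%:R * d.
  rewrite mulr_natl -sumr_const; apply: ler_sum => v vZ.
  exact: deg (subsetP ZU v vZ).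
have degZ' : \sum_(v in U :\: Z) \sum_(u in Z) l v u <= #|Z|%:R * d.
  rewrite exchange_big /=; apply: le_trans degZ; apply: ler_sum => v vZ.
  rewrite sumZ -[leLHS]add0r lerD ?sumr_ge0 //.
  by apply: ler_sum => u _; rewrite l_sym.
rewrite sumZ; under [X in _ + X]eq_bigr => v _ do rewrite sumZ.
by rewrite big_split /=; lra.
Qed.

(* At a vertex of maximal degree [d] of [U], either the degree is comparable to
   its expectation, or a single edge carries half of it, or else, the heaviest
   edge being set aside, some superlevel set of the star is dense in [U]. *)
Lemma exists_gadget (U : {set V}) : U != set0 ->
  exists g, [/\ gsupp g \subset U, gsupp g != set0 &
    \sum_(v in U) \sum_(u in U) l v u <=
    \sum_(v in U :\: gsupp g) \sum_(u in U :\: gsupp g) l v u + gval g].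
Proof.
case/set0Pn => v0 v0U.
pose deg v := \sum_(u in U) l v u.
have [v vU vmax] : exists2 v, v \in U & forall u, u \in U -> deg u <= deg v.
  by case: (arg_maxP deg v0U) => v vU vmax; exists v.
suff [g [sg g0 le]] : exists g, [/\ gsupp g \subset U, gsupp g != set0 &
    2 * #|gsupp g|%:R * deg v <= gval g].
  exists g; split=> //; apply: le_trans (induced_sum_remove sg vmax) _.
  by rewrite lerD2l.
have d0 : 0 <= deg v by apply: sumr_ge0.
have [small|big] := leP (deg v) (64 * p * wdeg v).
  exists (inl (inl v)); rewrite /= sub1set vU -card_gt0 cards1; split=> //.
  by lra.
have [/exists_inP[u uU heavy]|] := boolP [exists u in U, deg v / 2 <= l v u].
  exists (inl (inr (v, u))); rewrite /= subUset !sub1set vU uU; split=> //.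
    by apply/set0Pn; exists v; rewrite !inE eqxx.
  have c2 : #|[set v; u]|%:R <= 2 :> K by rewrite ler_nat cards2; case: eqP.
  by have := ler_wpM2r d0 c2; lra.
rewrite negb_exists_in => /forall_inP light.
have w0 := wdeg_ge0 v.
have dpos : 0 < deg v by apply: le_lt_trans big; rewrite !mulr_ge0 // ltW.
have wpos : 0 < wdeg v.
  apply: lt_le_trans dpos _; rewrite /deg /wdeg [leRHS](bigID (mem U)) /=.
  by rewrite -[leLHS]addr0 lerD // sumr_ge0.
have [t1 t1U t1max] : exists2 t, t \in U & forall u, u \in U -> l v u <= l v t.
  by case: (arg_maxP (l v) vU) => t tU tmax; exists t.
have half : deg v / 2 <= \sum_(u in U :\ t1) l v u.
  have := light _ t1U; rewrite -ltNge.
  have -> : deg v = l v t1 + \sum_(u in U :\ t1) l v u by rewrite /deg (big_setD1 t1).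
  by lra.
(* As [deg v > 64 p * wdeg v], this density exceeds the [32 p] asked of a dense star. *)
pose Q := deg v / (2 * wdeg v).
have Q0 : 0 <= Q by rewrite divr_ge0 // mulr_ge0.
have [] := @dense_upset K V (l v) (fun=> 1) (U :\ t1) Q (l_ge0 v) (fun=> ler01) Q0.
- under eq_bigr do rewrite mul1r.
  by rewrite -/(wdeg v); apply: le_trans half; rewrite /Q invfM mulrA divfK // gt_eqF.
- by apply: lt_le_trans half; rewrite divr_gt0.
move=> t /andP[tU lt0]; rewrite sumr_const.
set T := upset (l v) t; set k := #|_ :&: _| => dense.
have tT : t \in T by rewrite inE.
have SE : U :&: T = t1 |: ((U :\ t1) :&: T).
  apply/setP => s; rewrite !inE; have [->|] := eqVneq s t1 => //=.
  by rewrite t1U t1max //; move: tU; rewrite !inE => /andP[].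
have cS : #|U :&: T| = k.+1 by rewrite SE cardsU1 !inE eqxx add1n.
have k0 : (0 < k)%N by rewrite card_gt0; apply/set0Pn; exists t; rewrite inE tU.
have T0 : 0 < #|T|%:R :> K by rewrite ltr0n card_gt0; apply/set0Pn; exists t.
have dk : deg v * #|T|%:R <= 2 * wdeg v * k%:R.
  have w2 : 0 < 2 * wdeg v by rewrite mulr_gt0.
  by move: dense; rewrite /Q mulrAC ler_pdivrMr // [_ * k%:R]mulrC.
exists (inr (v, t, U :&: T)); rewrite /=; split.
- by rewrite subUset sub1set vU subsetIl.
- by apply/set0Pn; exists v; rewrite !inE eqxx.
have -> : (0 < l v t) && dense_star v t (U :&: T).
  rewrite lt0 /dense_star -/T cS ltnS k0 subsetIr inE tT andbT /=.
  apply/andP; split; first by move: tU; rewrite inE => /andP[].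
  apply: le_trans dense; rewrite ler_wpM2r ?(ltW T0) //.
  by rewrite /Q ler_pdivlMr ?mulr_gt0 //; lra.
rewrite -/T cS -!mulrA [_^-1 * _]mulrC !mulrA ler_pdivlMr //.
have c2 : #|v |: U :&: T|%:R <= k%:R + 2 :> K.
  by rewrite -natrD ler_nat cardsU1 cS addn2; case: (_ \notin _).
apply: (@le_trans _ _ (2 * (k%:R + 2) * (deg v * #|T|%:R))).
  rewrite -(mulrA _ (deg v)) ler_wpM2r ?mulr_ge0 ?(ltW T0) //.
  by rewrite ler_pM2l.
apply: le_trans (ler_wpM2l _ dk) _; first by rewrite mulr_ge0 // addr_ge0.
(* The density bound counts [k] leaves and the support has at most [k + 2] vertices; the square of
   the [k + 1] leaves pays for the product. *)
have kk : k%:R * (k%:R + 2) <= k.+1%:R ^+ 2 :> K.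
  by rewrite -natr1; nra.
by have := ler_wpM2r w0 kk; lra.
Qed.

(** Extract a gadget, delete its support from [U] and recurse: later gadgets avoid it. *)
Lemma induced_sum_le_gadgets (U : {set V}) :
  exists J : {set gadget},
    [/\ disjoint_supports gsupp J, forall g, g \in J -> gsupp g \subset U &
        \sum_(v in U) \sum_(u in U) l v u <= \sum_(g in J) gval g].
Proof.
have [n cU] := ubnP #|U|; elim: n U cU => // n IH U cU.
have [->|U0] := eqVneq U set0.
  exists set0; rewrite !big_set0; split=> // [|g]; last by rewrite inE.
  by apply/disjoint_supportsP => g; rewrite inE.
have [g [sg g0 le]] := exists_gadget U0.
have ltU : (#|U :\: gsupp g| < n)%N.
  rewrite ltnS in cU; apply: leq_trans cU; apply: proper_card.
  rewrite properE subsetDl /=; case/set0Pn: g0 => v vg.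
  by apply/subsetPn; exists v; rewrite ?(subsetP sg) // inE vg.
have [J [dJ sJ leJ]] := IH _ ltU.
have disj h : h \in J -> [disjoint gsupp g & gsupp h].
  move=> /sJ; rewrite subsetD => /andP[_]; by rewrite disjoint_sym.
have gJ : g \notin J.
  apply: contraNN g0 => /disj; by rewrite -setI_eq0 setIid.
exists (g |: J); split.
- apply/disjoint_supportsP => h h'; rewrite !inE.
  case/predU1P => [->|hJ] /predU1P[->|h'J]; rewrite ?eqxx // => hh'.
  + exact: disj.
  + by rewrite disjoint_sym disj.
  + by have /disjoint_supportsP := dJ; apply.
- move=> h; rewrite !inE => /predU1P[->//|/sJ].
  by rewrite subsetD => /andP[].
- by rewrite big_setU1 //= addrC; apply: le_trans le _; rewrite lerD2r.
Qed.

End Gadgets.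

(** * From the weighted graph to gadgets *)

(** Each edge comes from exactly two ordered pairs, distinct by irreflexivity. *)
Lemma sum_adjacent_pairs (K : realType) (V : finType) (G : sgraph V)
    (lam : {set V} -> K) (U : {set V}) :
  \sum_(v in U) \sum_(u in U) (if adj G v u then lam [set v; u] else 0) =
  2 * weight lam (induced_edges G U).
Proof.
rewrite /weight mulr_sumr pair_big /= -big_mkcondr /=.
pose h (vu : V * V) := [set vu.1; vu.2].
rewrite (partition_big h (mem (induced_edges G U))) /=; last first.
  move=> [v u] /= /andP[/andP[vU uU] vu]; rewrite inE subUset !sub1set vU uU !andbT.
  by apply/imset2P; exists v u; rewrite ?inE.
apply: eq_bigr => e; rewrite inE => /andP[/imset2P[v u _]].
rewrite inE /= => vu -> ; rewrite subUset !sub1set => /andP[vU uU].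
have vNu : v != u by apply: contraTneq vu => ->; rewrite adj_irr.
rewrite (bigD1 (v, u)) /=; last by rewrite vU uU vu eqxx.
rewrite (bigD1 (u, v)) /=; last first.
  by rewrite vU uU adj_sym vu /h /= setUC eqxx xpair_eqE (negbTE vNu) andbF.
rewrite big1 ?addr0 => [|[a b]]; first by rewrite [[set u; v]]setUC mulr2n mulrDl mul1r.
case/andP => /andP[/andP[/andP[_ ab] /eqP eqab]]; rewrite !xpair_eqE.
have aNb : a != b by apply: contraTneq ab => ->; rewrite adj_irr.
have : a \in [set v; u] by rewrite -eqab !inE eqxx.
have : b \in [set v; u] by rewrite -eqab !inE eqxx orbT.
rewrite !inE => /orP[]/eqP bE /orP[]/eqP aE; move: aNb;
  by rewrite bE aE ?eqxx.
Qed.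

Theorem theorem3p1 (K : realType) :
  exists C : K, 0 < C /\
    forall (V : finType) (G : sgraph V) (p : K) (lam : {set V} -> K) (r : K),
      0 <= p <= 1 ->
      (forall e, e \in edges G -> 0 <= lam e) ->
      4096 * Num.sqrt 2 * expR 1 <= r ->
      p != 0 ->
      weight lam (edges G) != 0 ->
      min_cost p (heavy_sets G p lam r) <= C / r.
Proof.
(* [1120 = 8 * 140]: the cover costs at most [8 / (r ^+ 2 / 140)], and [1 <= r] absorbs one factor
   [1 / r]. *)
exists 1120; split=> // V G p lam r /andP[p0 _] lam0 rbig pN0 WN0.
have p_gt0 : 0 < p by rewrite lt_neqAle eq_sym pN0.
have r_ge : 4096 <= r.
  apply: le_trans rbig; rewrite -mulrA -[leLHS]mulr1 ler_pM2l //.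
  have s1 : 1 <= Num.sqrt 2 :> K by rewrite -[leLHS]sqrtr1 ler_sqrt ?ltr0n ?ler1n.
  have e1 : 1 <= expR 1 :> K by rewrite ltW ?expR_gt1.
  by rewrite -[leLHS]mulr1 ler_pM.
set W := weight lam (edges G).
have W_gt0 : 0 < W by rewrite lt_neqAle eq_sym WN0 sumr_ge0.
pose l v u := if adj G v u then lam [set v; u] else 0.
have l_ge0 v u : 0 <= l v u.
  rewrite /l; case: ifP => // vu; apply: lam0.
  by apply/imset2P; exists v u; rewrite ?inE.
have l_sym v u : l v u = l u v by rewrite /l adj_sym setUC.
have l_irr v : l v v = 0 by rewrite /l adj_irr.
have sumW : \sum_v wdeg l v = 2 * W.
  have := sum_adjacent_pairs G lam setT.
  have -> : induced_edges G setT = edges G.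
    by apply/setP => e; rewrite inE subsetT andbT.
  rewrite -/W => <-; apply: eq_big => [v|v _]; first by rewrite inE.
  by apply: eq_bigl => u; rewrite inE.
have Qge : 8 <= r ^+ 2 / 140 by rewrite ler_pdivlMr //; nra.
have min_le := @min_cost_disjoint_supports K _ _ p (@gsupp V) (gval l p)
  (r ^+ 2 / 140) (heavy_sets G p lam r) p0 (gval_ge0 l_ge0 p_gt0) Qge.
apply: le_trans (min_le _) _ => [U|].
  rewrite inE -/W => heavyU.
  have [J [dJ sJ leJ]] := induced_sum_le_gadgets l_ge0 l_sym p_gt0 U.
  rewrite sum_adjacent_pairs in leJ.
  have r2 : 0 < r ^+ 2 by rewrite exprn_gt0 //; lra.
  exists J; split=> //.
    apply: lt_le_trans leJ; rewrite mulr_gt0 //; apply: lt_le_trans heavyU.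
    by rewrite mulr_gt0 ?exprn_gt0 // mulr_gt0.
  (* Both sides count ordered pairs, so the factors 2 cancel and [140] is absorbed by
     [Q = r ^+ 2 / 140]. *)
  apply: le_trans leJ; apply: le_trans (_ : 2 * (r ^+ 2 * W * p ^+ 2) <= _).
    have Q0 : 0 <= r ^+ 2 / 140 by lra.
    have := ler_wpM2l Q0 (sum_gval_le l_ge0 l_irr p_gt0).
    by rewrite sumW; lra.
  by rewrite ler_pM2l.
have r0 : 0 < r by lra.
have -> : 8 / (r ^+ 2 / 140) = 1120 / r / r by field; rewrite gt_eqF.
by rewrite ler_pdivrMr // ler_peMr ?divr_ge0 ?(ltW r0) //; lra.
Qed.
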